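(* Let $n$ be a composite integer, let $k$ be a divisor of $n$ with $2\le k\le n-1$, and let $m$ be a divisor of $n/k$ with $2\le m\le n/k-1$. Let $D=\{d\in D_n\mid k\nmid d\}\cup kmD_{n/(km)}$, where $kmD_{n/(km)}=\{km\,\delta\mid \delta\in D_{n/(km)}\}$. Then the adjacency spectrum of the integral circulant graph $\mathrm{ICG}_n(D)$ contains exactly four distinct eigenvalues.
   Context: For a positive integer $r$, $D_r$ denotes the set of positive divisors of $r$ other than $r$ itself. For $D\subseteq D_n$, the integral circulant graph $\mathrm{ICG}_n(D)$ is the graph on $\mathbb{Z}_n=\{0,\ldots,n-1\}$ in which $i$ and $j$ are adjacent iff $\gcd(i-j,n)\in D$. *)

(* Defs.v *)
From HB Require Import structures.
From mathcomp Require Import all_boot all_order all_algebra.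

Set Implicit Arguments.
Unset Strict Implicit.
Unset Printing Implicit Defensive.

Import GRing.Theory Num.Theory.

Definition composite (n : nat) : bool := (1 < n) && ~~ prime n.

Definition proper_divisors (r : nat) : seq nat :=
  [seq d <- divisors r | d != r].

(* The difference i - j is taken in int, so that no subtraction is truncated;
   gcdz is the nonnegative gcd, hence its absolute value loses nothing. *)
Definition ICG (n : nat) (D : seq nat) : rel 'I_n :=
  fun i j => `|gcdz (i%:Z - j%:Z)%R n%:Z|%N \in D.

Definition adjacency_mx (R : nzRingType) (n : nat) (e : rel 'I_n) : 'M[R]_n :=
  (\matrix_(i, j) (e i j)%:R)%R.

Definition distinct_eigenvalues (F : fieldType) (n : nat) (A : 'M[F]_n)
    (c : nat) : Prop :=
  exists s : seq F,
    [/\ uniq s, size s = c & forall x : F, (x \in s) = eigenvalue A x].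

Definition four_eigenvalue_divisors (n k m : nat) : seq nat :=
  [seq d <- proper_divisors n | ~~ (k %| d)]
  ++ [seq k * m * delta | delta <- proper_divisors (n %/ (k * m))].

Lemma mem_proper_divisors (r d : nat) :
  0 < r -> (d \in proper_divisors r) = (d %| r) && (d != r).
Proof. by move=> r0; rewrite mem_filter -dvdn_divisors // andbC. Qed.

Lemma ICG_sym (n : nat) (D : seq nat) : symmetric (@ICG n D).
Proof. by move=> i j; rewrite /ICG -opprB /gcdz abszN. Qed.

Lemma ICG_irrefl (n : nat) (D : seq nat) :
  {subset D <= proper_divisors n} -> irreflexive (@ICG n D).
Proof.
move=> sD i; apply/negP => /sD.
by rewrite /ICG subrr gcd0z !absz_nat mem_filter eqxx.
Qed.

Lemma four_eigenvalue_divisors_sub (n k m : nat) :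
  0 < n -> k %| n -> m %| n %/ k ->
  {subset four_eigenvalue_divisors n k m <= proper_divisors n}.
Proof.
move=> n0 kn mnk d; rewrite mem_cat => /orP[|/mapP[e]].
  by rewrite mem_filter => /andP[].
have k0 : 0 < k by apply: dvdn_gt0 kn.
have m0 : 0 < m by apply: dvdn_gt0 mnk; rewrite divn_gt0 // dvdn_leq.
have kmn : k * m %| n by rewrite -(divnK kn) mulnC dvdn_pmul2r.
have km0 : 0 < k * m by rewrite muln_gt0 k0.
have q0 : 0 < n %/ (k * m) by rewrite divn_gt0 // dvdn_leq.
rewrite mem_proper_divisors // => /andP[eq ne] ->.
rewrite mem_proper_divisors // -{1 2}(divnK kmn) [X in _ %| X]mulnC.
by rewrite dvdn_pmul2l // eq /= mulnC eqn_pmul2r.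
Qed.

(* Main.v *)
Require Import Defs.
From HB Require Import structures.
From mathcomp Require Import all_boot all_order all_algebra.
From mathcomp Require Import zify ring.

Import GRing.Theory Num.Theory.

(** Writing [K d] for the 0/1 matrix of congruence modulo [d], the adjacency
    matrix is [A = K 1 - K k + K (k * m) - 1].  If [d %| e %| n], then
    [K d *m K e = K e *m K d = (n / e) K d], so these matrices span a
    commutative algebra in which [A] has the eigenvalues
    [n - b + c - 1, - b + c - 1, c - 1, - 1], where [b = n / k] and
    [c = n / (k * m)]: they are taken on the images of [K 1], [k K k - K 1],
    [m K (k * m) - K k] and [c - K (k * m)], which are all nonzero. *)

(** Each of the [q] blocks of [e] consecutive integers meets the residue class of [j] exactly once,
    at offset [j %% e]. *)
Lemma sum_eq_mod (e q j : nat) : 0 < e ->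
  \sum_(0 <= l < q * e) (l == j %[mod e]) = q.
Proof.
move=> e0; elim: q => [|q IHq]; first by rewrite big_geq.
rewrite (big_cat_nat (n := q * e)) ?leq_mul2r ?leqnSn ?orbT //= IHq.
rewrite -{1}[q * e]add0n big_addn -mulnBl subSnn mul1n -addn1.
have shift l : l + q * e = l %[mod e] by rewrite addnC modnMDl.
congr (_ + _); rewrite big_mkord.
rewrite (bigD1 (Ordinal (ltn_pmod j e0))) //= shift modn_mod eqxx.
rewrite big1 // => i; rewrite -val_eqE /= shift.
by rewrite (modn_small (ltn_ord i)) => /negbTE ->.
Qed.

Section CongruenceMatrix.

Local Open Scope ring_scope.

Variables (R : nzRingType) (n : nat).

Definition cong_mx (d : nat) : 'M[R]_n :=
  \matrix_(i, j) (i == j %[mod d])%N%:R.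

Lemma cong_mx_tr (d : nat) : (cong_mx d)^T = cong_mx d.
Proof. by apply/matrixP => i j; rewrite !mxE eq_sym. Qed.

Lemma cong_mx_diag (d : nat) (i : 'I_n) : cong_mx d i i = 1.
Proof. by rewrite mxE eqxx. Qed.

(** The entry at [i], [j] counts the [l < n] with [l = i] modulo [d] and [l = j] modulo [e]. As
    [d %| e], the second condition turns the first into [i = j] modulo [d], and it has [n %/ e]
    solutions. *)
Lemma mul_cong_mx (d e : nat) : (d %| e)%N -> (e %| n)%N ->
  cong_mx d *m cong_mx e = (n %/ e)%:R *: cong_mx d.
Proof.
move=> de en; apply/matrixP => i j; rewrite !mxE.
have e0 : (0 < e)%N by apply: dvdn_gt0 en; apply: leq_ltn_trans (ltn_ord i).
rewrite -[X in (X %/ e)%N](divnK en) mulnK //.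
(* Expanding the scalar into a count over [l] lets the two sides be compared term by term. *)
rewrite -[X in X%:R * _](@sum_eq_mod e (n %/ e) j e0) divnK // big_mkord.
rewrite natr_sum mulr_suml; apply: eq_bigr => l _; rewrite !mxE -!natrM.
rewrite mulnC; case: (eqVneq (l %% e)%N) => [elj|]; last by rewrite !mul0n.
by rewrite -(modn_dvdm l de) elj (modn_dvdm j de).
Qed.

End CongruenceMatrix.

Lemma mul_cong_mxC (R : comNzRingType) (n d e : nat) : d %| e -> e %| n ->
  (cong_mx R n e *m cong_mx R n d = (n %/ e)%:R *: cong_mx R n d)%R.
Proof.
move=> de en; apply: trmx_inj.
by rewrite trmx_mul linearZ /= !cong_mx_tr mul_cong_mx.
Qed.

(** Any nonzero row of [B] is an eigenvector, so whole matrices can serve as witnesses. *)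
Lemma eigenvalue_mx (F : fieldType) (p n : nat) (A : 'M[F]_n)
    (B : 'M[F]_(p, n)) (x : F) :
  (B != 0 -> B *m A = x *: B -> eigenvalue A x)%R.
Proof.
move=> B0 BA; have [i Bi0] : exists i, (row i B != 0)%R.
  apply/existsP; apply: contraR B0; rewrite negb_exists => /forallP B0.
  by apply/eqP/row_matrixP => i; rewrite row0; apply/eqP; rewrite -[_ == _]negbK B0.
by apply/eigenvalueP; exists (row i B); rewrite // -row_mul BA linearZ.
Qed.

Lemma dvdn_gcd_sub (n d : nat) (i j : 'I_n) : d %| n ->
  (d %| `|gcdz (i%:Z - j%:Z)%R n%:Z|) = (i == j %[mod d]).
Proof.
move=> dn; have := eqz_mod_dvd d%:Z i%:Z j%:Z.
rewrite !modz_nat eqz_nat => ->.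
by rewrite /gcdz absz_nat dvdn_gcd absz_nat dn andbT dvdzE.
Qed.

(** For [g] the gcd of [i - j] and [n], divisibility of [g] by [k] or [k * m] is a congruence, and
    [g = n] means [i = j]. The second part of the divisor set consists of the divisors of [n], other
    than [n], that [k * m] divides. *)
Lemma ICG_four_eigenvalue_divisors (n k m : nat) (i j : 'I_n) :
  k %| n -> k * m %| n ->
  @ICG n (four_eigenvalue_divisors n k m) i j
    = ~~ (i == j %[mod k]) || (i == j %[mod k * m]) && (i != j).
Proof.
move=> kn kmn; have n0 : 0 < n by apply: leq_ltn_trans (ltn_ord i).
have km0 : 0 < k * m by apply: dvdn_gt0 kmn.
rewrite /ICG -(dvdn_gcd_sub n k i j kn) -(dvdn_gcd_sub n (k * m) i j kmn).
have gn : `|gcdz (i%:Z - j%:Z)%R n%:Z| %| n.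
  by rewrite /gcdz absz_nat dvdn_gcdr.
have -> : (i != j) = (`|gcdz (i%:Z - j%:Z)%R n%:Z| != n).
  congr (~~ _); rewrite -val_eqE /= -[in LHS](modn_small (ltn_ord i)).
  rewrite -[in LHS](modn_small (ltn_ord j)) -(dvdn_gcd_sub n n i j) //.
  by rewrite eqn_dvd gn.
move: gn; set g := `|_|%N => gn.
rewrite mem_cat mem_filter mem_proper_divisors // gn /=; congr (_ || _).
  (* The value [g = n] is already excluded on both sides, since [k %| n]. *)
  by case: eqVneq => [->|]; rewrite ?kn ?andbT ?andbF.
have q0 : 0 < n %/ (k * m) by rewrite divn_gt0 // dvdn_leq.
apply/mapP/andP => [[e]|[/dvdnP[e ge] gNn]].
  rewrite mem_proper_divisors // => /andP[_ eN] ->; split; first exact: dvdn_mulr.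
  by apply: contraNneq eN => <-; rewrite mulKn.
exists e; last by rewrite ge mulnC.
rewrite mem_proper_divisors //; apply/andP; split.
  by rewrite -(dvdn_pmul2r km0) -ge divnK.
by apply: contraNneq gNn => ee; rewrite ge ee divnK.
Qed.

Section FourEigenvalues.

Local Open Scope ring_scope.

Variables (C : numFieldType) (n k m : nat).
Hypotheses (n_gt0 : (0 < n)%N) (k_dvd : (k %| n)%N) (km_dvd : (k * m %| n)%N).

Let K := cong_mx C n.
Let A := adjacency_mx C (@ICG n (four_eigenvalue_divisors n k m)).
Let b : C := (n %/ k)%:R.
Let c : C := (n %/ (k * m))%:R.

Lemma adjacency_cong_mxE : A = K 1 - K k + K (k * m)%N - 1%:M.
Proof.
apply/matrixP => i j; rewrite !mxE ICG_four_eigenvalue_divisors // !modn1 eqxx.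
have [<-|nij] := eqVneq i j; first by rewrite !eqxx /=; ring.
rewrite andbT; have [ekm|_] := eqVneq (i %% (k * m))%N (j %% (k * m))%N.
  have -> : (i == j %[mod k])%N.
    by rewrite -(modn_dvdm i (dvdn_mulr m (dvdnn k))) ekm modn_dvdm ?dvdn_mulr.
  by rewrite /=; ring.
by case: (_ == _ :> nat) => /=; ring.
Qed.

Let k_dvd_km : (k %| k * m)%N := dvdn_mulr m (dvdnn k).

(** Here and in the next two lemmas, [A] acts triangularly on [K 1], [K k], [K (k * m)], with three
    of the eigenvalues on the diagonal. *)
Lemma mul_cong1_adjacency : K 1 *m A = (n%:R - b + c - 1) *: K 1.
Proof.
rewrite adjacency_cong_mxE !(mulmxBr, mulmxDr) !mul_cong_mx ?dvd1n // mulmx1 divn1.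
by rewrite !scalerBl scalerDl scalerBl scale1r.
Qed.

Lemma mul_congk_adjacency : K k *m A = b *: K 1 + (- b + c - 1) *: K k.
Proof.
rewrite adjacency_cong_mxE !(mulmxBr, mulmxDr) mul_cong_mxC ?dvd1n //.
rewrite !mul_cong_mx // mulmx1.
by rewrite !(scalerBl, scalerDl) scaleNr scale1r !addrA.
Qed.

Lemma mul_congkm_adjacency :
  K (k * m)%N *m A = c *: K 1 - c *: K k + (c - 1) *: K (k * m)%N.
Proof.
rewrite adjacency_cong_mxE !(mulmxBr, mulmxDr) !mul_cong_mxC ?dvd1n // mulmx1.
by rewrite !(scalerBl, scalerDl) scale1r !addrA.
Qed.

(** By triangularity, the first nonzero vector among [v *m K 1], [v *m K k], [v *m K (k * m)]
    determines [x]; if all three vanish, then [v *m A = - v]. *)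
Lemma eigenvalue_adjacency_sub (x : C) : eigenvalue A x ->
  x \in [:: n%:R - b + c - 1; - b + c - 1; c - 1; - 1].
Proof.
case/eigenvalueP => v vA v0; rewrite !inE.
have trA : A^T = A by apply/matrixP => i j; rewrite !mxE ICG_sym.
(* Symmetry of [A] and [B] gives [A *m B = (B *m A)^T], so the triangular relations apply to [v]. *)
have eigenK (B : 'M[C]_n) : B^T = B -> x *: (v *m B) = v *m (B *m A)^T.
  by move=> trB; rewrite trmx_mul trA trB mulmxA vA scalemxAl.
have eigen0 (y : C) (w : 'rV[C]_n) : x *: w = y *: w -> w = 0 \/ x = y.
  move/eqP; rewrite -subr_eq0 -scalerBl scaler_eq0 subr_eq0.
  by case/orP => /eqP ->; [right|left].
have := eigenK _ (cong_mx_tr C n 1).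
rewrite mul_cong1_adjacency linearZ /= cong_mx_tr -scalemxAr.
case/eigen0 => [v1|->]; last by rewrite eqxx.
have := eigenK _ (cong_mx_tr C n k).
rewrite mul_congk_adjacency !(linearD, linearZ) /= !cong_mx_tr.
rewrite v1 scaler0 add0r.
case/eigen0 => [vk|->]; last by rewrite eqxx orbT.
have := eigenK _ (cong_mx_tr C n (k * m)).
rewrite mul_congkm_adjacency !(linearD, linearZ, linearN) /= !cong_mx_tr.
rewrite v1 vk !(scaler0, oppr0, add0r).
case/eigen0 => [vkm|->]; last by rewrite eqxx !orbT.
move: vA; rewrite adjacency_cong_mxE !(mulmxDr, mulmxN) mulmx1.
rewrite v1 vk vkm subrr !add0r -scaleN1r => /esym/eigen0[v00|->].
  by rewrite v00 eqxx in v0.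
by rewrite eqxx !orbT.
Qed.

Lemma eigenvalue_adjacency (x : C) :
  (1 < k)%N -> (1 < m)%N -> (1 < n %/ (k * m))%N ->
  x \in [:: n%:R - b + c - 1; - b + c - 1; c - 1; - 1] -> eigenvalue A x.
Proof.
move=> k1 m1 c1.
(* The relations [b = m c] and [n = k b] cancel the off-diagonal terms for the second and third
   witnesses. *)
have bE : b = m%:R * c.
  rewrite /b /c -natrM divnMA mulnC divnK // dvdn_divRL //.
  by rewrite mulnC.
have nE : n%:R = k%:R * b :> C by rewrite /b -natrM mulnC divnK.
pose i0 := Ordinal n_gt0.
(* The corner entries of the four witnesses are [1], [k - 1], [m - 1] and [c - 1]. *)
have nz (B : 'M[C]_n) : B i0 i0 != 0 -> B != 0.
  by apply: contraNneq => ->; rewrite mxE.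
have natB1_neq0 (q : nat) : (1 < q)%N -> q%:R - 1 != 0 :> C.
  by move=> q1; rewrite subr_eq0 pnatr_eq1 gtn_eqF.
rewrite !inE => /or4P[] /eqP ->.
- apply: eigenvalue_mx mul_cong1_adjacency.
  by apply: nz; rewrite cong_mx_diag oner_neq0.
- apply: (@eigenvalue_mx _ _ _ _ (k%:R *: K k - K 1)).
    by apply: nz; rewrite !mxE !eqxx mulr1 natB1_neq0.
  rewrite mulmxBl -scalemxAl mul_congk_adjacency mul_cong1_adjacency nE.
  by apply/matrixP => i j; rewrite !mxE; ring.
- apply: (@eigenvalue_mx _ _ _ _ (m%:R *: K (k * m)%N - K k)).
    by apply: nz; rewrite !mxE !eqxx mulr1 natB1_neq0.
  rewrite mulmxBl -scalemxAl mul_congk_adjacency mul_congkm_adjacency bE.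
  by apply/matrixP => i j; rewrite !mxE; ring.
- apply: (@eigenvalue_mx _ _ _ _ (c%:M - K (k * m)%N)).
    by apply: nz; rewrite !mxE !eqxx mulr1n natB1_neq0.
  rewrite mulmxBl mul_scalar_mx mul_congkm_adjacency adjacency_cong_mxE.
  by rewrite -scalemx1; apply/matrixP => i j; rewrite !mxE; ring.
Qed.

(** All pairwise differences are nonzero because [n > b > c > 0]; in characteristic zero this can be
    checked over the integers. *)
Lemma uniq_four_eigenvalues :
  (1 < k)%N -> (1 < m)%N -> uniq [:: n%:R - b + c - 1; - b + c - 1; c - 1; - 1].
Proof.
move=> k1 m1.
have c0 : (0 < n %/ (k * m))%N.
  by rewrite divn_gt0 (dvdn_leq n_gt0 km_dvd, dvdn_gt0 n_gt0 km_dvd).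
have bE : (n %/ k = m * (n %/ (k * m)))%N.
  by rewrite divnMA mulnC divnK // dvdn_divRL // mulnC.
have nE : (n = k * (n %/ k))%N by rewrite mulnC divnK.
pose s : seq int := [:: n%:Z - (n %/ k)%:Z + (n %/ (k * m))%:Z - 1;
  - (n %/ k)%:Z + (n %/ (k * m))%:Z - 1; (n %/ (k * m))%:Z - 1; - 1].
have -> : [:: n%:R - b + c - 1; - b + c - 1; c - 1; - 1] = [seq y%:~R | y <- s].
  by rewrite /= !(rmorphD, rmorphN) /= -!pmulrn.
rewrite map_inj_uniq; last exact: intr_inj.
rewrite /s; move: nE bE c0.
move: (n %/ k)%N (n %/ (k * m))%N => b' c' nE bE c0.
by rewrite /= !inE; nia.
Qed.

End FourEigenvalues.

Theorem theorem4p5 (C : numClosedFieldType) (n k m : nat)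
    (hn : composite n)
    (hkn : k %| n) (hk : 2 <= k <= n - 1)
    (hmn : m %| n %/ k) (hm : 2 <= m <= n %/ k - 1) :
  distinct_eigenvalues
    (adjacency_mx C (@ICG n (four_eigenvalue_divisors n k m))) 4.
Proof.
have n0 : 0 < n by case/andP: hn => /ltnW.
case/andP: hk => k1 _; case/andP: hm => m1 m_lt.
have kmn : k * m %| n by rewrite mulnC -dvdn_divRL.
have c1 : 1 < n %/ (k * m).
  (* With [n %/ k = r * m], the bound [m <= r * m - 1] rules out [r = 0] and [r = 1]. *)
  rewrite divnMA; move: hmn m_lt; set q := n %/ k => /dvdnP[r ->].
  by rewrite mulnK ?(ltnW m1) //; case: r => [|[|r]]; lia.
eexists; split; [exact: (@uniq_four_eigenvalues C n k m) | by [] | move=> x].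
apply/idP/idP; first exact: eigenvalue_adjacency.
exact: eigenvalue_adjacency_sub.
Qed.
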